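(* Let $n\ge2$, let $\mathcal{L}\subset\mathbb{R}^n$ be the second order (Lorentz) cone, let $A=A^\top\in\mathbb{R}^{n\times n}$ have at least two distinct eigenvalues, let $\lambda_1\le\lambda_2\le\dots\le\lambda_n$ be the eigenvalues of $A$, let $v^1$ be an eigenvector of $A$ corresponding to $\lambda_1$, and let $J=\operatorname{diag}(1,-1,\dots,-1)\in\mathbb{R}^{n\times n}$. If $v^1\in\mathcal{L}$ and there exists $\rho\ge0$ such that $\lambda_2I_n-A-\rho J$ is positive semidefinite, then $q_A:\mathbb{S}^{n-1}\cap\operatorname{int}(\mathcal{L})\to\mathbb{R}$, $q_A(x)=\langle Ax,x\rangle$, is spherically quasi-convex.
   Context: $\mathcal{L}=\{x=(x_1,\dots,x_n)^\top\in\mathbb{R}^n: x_1\ge\sqrt{x_2^2+\dots+x_n^2}\}$ and $\mathbb{S}^{n-1}=\{x\in\mathbb{R}^n:\|x\|=1\}$. For $x,y\in\mathbb{S}^{n-1}$ with $y\ne\pm x$ the minimal geodesic from $x$ to $y$ is the constant-speed parametrization $[0,1]\to\mathbb{S}^{n-1}$ of the shorter great-circle arc from $x$ to $y$. A function $f:\mathcal{S}\to\mathbb{R}$ on $\mathcal{S}=\mathbb{S}^{n-1}\cap\operatorname{int}(\mathcal{L})$ is spherically quasi-convex if for every minimal geodesic segment $\gamma:[0,1]\to\mathcal{S}$ the composition $f\circ\gamma$ is quasi-convex in the usual sense. *)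

(* Defs.v *)
(* MathComp + MathComp-Analysis, over an arbitrary [R : realType]. *)
From HB Require Import structures.
From mathcomp Require Import all_boot all_order all_algebra.
From mathcomp Require Import all_classical all_reals all_analysis.

Set Implicit Arguments.
Unset Strict Implicit.
Unset Printing Implicit Defensive.

Import Order.TTheory GRing.Theory Num.Theory.
Import numFieldNormedType.Exports.

Local Open Scope classical_set_scope.
Local Open Scope ring_scope.

Definition dot (R : realType) n (x y : 'cV[R]_n) : R :=
  \sum_(i < n) x i ord0 * y i ord0.

(* The library norm [`|x|] on matrices is the sup norm, hence this one. *)
Definition eucl_norm (R : realType) n (x : 'cV[R]_n) : R :=
  Num.sqrt (dot x x).

Definition sphere (R : realType) n : set 'cV[R]_n :=
  [set x | eucl_norm x = 1].
Arguments sphere : clear implicits.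

(* Coordinates are numbered from 0: the distinguished coordinate x_1 is
   [x ord0 ord0]. *)
Definition lorentz (R : realType) n : set 'cV[R]_n.+1 :=
  [set x | Num.sqrt (\sum_(i < n.+1 | i != ord0) x i ord0 ^+ 2)
             <= x ord0 ord0].
Arguments lorentz : clear implicits.

Definition lorentzJ (R : realType) n : 'M[R]_n.+1 :=
  diag_mx (\row_(j < n.+1) (if j == ord0 then 1 else - 1)).
Arguments lorentzJ : clear implicits.

(* The interior is taken for the library topology of ['cV[R]_n.+1], which is
   the usual topology of R^n.+1. *)
Definition sphere_lorentz (R : realType) n : set 'cV[R]_n.+1 :=
  sphere R n.+1 `&` interior (lorentz R n).
Arguments sphere_lorentz : clear implicits.

Definition psdmx (R : realType) n (M : 'M[R]_n) : Prop :=
  M^T = M /\ forall x : 'cV[R]_n, 0 <= dot (M *m x) x.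

Definition quad_form (R : realType) n (A : 'M[R]_n) (x : 'cV[R]_n) : R :=
  dot (A *m x) x.

(* [lam] lists the eigenvalues of [A] in nondecreasing order, repeated
   according to multiplicity. *)
Definition ordered_spectrum (R : realType) n (A : 'M[R]_n)
    (lam : n.-tuple R) : Prop :=
  sorted <=%R lam /\ char_poly A = \prod_(l <- lam) ('X - l%:P).

Definition eigenvector (R : realType) n (A : 'M[R]_n) (l : R)
    (v : 'cV[R]_n) : Prop :=
  v != 0 /\ A *m v = l *: v.

(* [g] runs with constant speed [theta] along the great circle spanned by the
   orthonormal pair [x], [u]; the arc has length [theta], and it is the shorter
   of the two arcs from [x] to [y] exactly because [theta < pi]. Only the
   values of [g] on [0, 1] matter. *)
Definition minimal_geodesic (R : realType) n (x y : 'cV[R]_n)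
    (g : R -> 'cV[R]_n) : Prop :=
  [/\ sphere R n x, sphere R n y, y != x, y != - x &
      exists (u : 'cV[R]_n) (theta : R),
        [/\ sphere R n u, dot x u = 0, 0 < theta < pi,
            forall t : R, 0 <= t <= 1 ->
              g t = cos (t * theta) *: x + sin (t * theta) *: u &
            g 1 = y]].

Definition quasiconvex_unit_interval (R : realType) (phi : R -> R) : Prop :=
  forall s t a : R, 0 <= s <= 1 -> 0 <= t <= 1 -> 0 <= a <= 1 ->
    phi ((1 - a) * s + a * t) <= Num.max (phi s) (phi t).

(* A function on [S] is represented by a total function, of which only the
   values on [S] are used. *)
Definition spherically_quasiconvex (R : realType) n (S : set 'cV[R]_n)
    (f : 'cV[R]_n -> R) : Prop :=
  forall (x y : 'cV[R]_n) (g : R -> 'cV[R]_n),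
    minimal_geodesic x y g ->
    (forall t : R, 0 <= t <= 1 -> S (g t)) ->
    quasiconvex_unit_interval (f \o g).

(* Main.v *)
Require Import Defs.
From HB Require Import structures.
From mathcomp Require Import all_boot all_order all_algebra.
From mathcomp Require Import all_classical all_reals all_analysis.
From mathcomp Require Import ring lra.
Import Order.TTheory GRing.Theory Num.Theory.
Import numFieldNormedType.Exports.

Set Implicit Arguments.
Unset Strict Implicit.

Local Open Scope classical_set_scope.
Local Open Scope ring_scope.

(** Quasi-convexity of [q_A] along an arc from [p] to [q] means that every
    point [r] of the arc satisfies [q_A r <= c], where [c] is the larger of
    [q_A p] and [q_A q]. The second eigenvalue [lambda_2] separates two cases.

    If [lambda_2 <= c], the bound holds on the whole cone: for a unit vector [r]
    the matrix inequality reads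
    [q_A r <= lambda_2 - rho * <J r, r>], and [<J r, r> >= 0] on the cone, so
    [q_A r <= lambda_2 <= c].

    If [c < lambda_2], put [B = A - c I]. The form of [B] is nonnegative on the
    hyperplane orthogonal to [v1] ([quad_form_ge_orthogonal]), so it has at
    most one negative direction, and its sublevel set at [0] is the union of a
    convex cone and the opposite cone. Concretely, the vector
    [<v1,q> p - <v1,p> q] is orthogonal to [v1]; expanding the nonnegative form
    at this vector, with [<B p, p> <= 0] and [<B q, q> <= 0], gives
    [<v1,p> <v1,q> <B p, q> <= 0]. The Lorentz cone is self-dual, hence
    [<v1,p>] and [<v1,q>] are positive for interior points
    ([dot_interior_lorentz_gt0]) and [<B p, q> <= 0]. So the form is
    nonpositive at every nonnegative combination of [p] and [q]
    ([quad_form_comb_le0]), and the points of a geodesic are such combinations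
    up to a positive factor ([great_circle_comb], [sin_mul_sin_ge0]).

    The spectral fact is proved without a spectral theorem: since the
    characteristic polynomial is split, a symmetric matrix with eigenvector
    [v] can be conjugated by a reflection into a block-diagonal matrix that
    isolates the eigenvalue and removes the matching linear factor from the
    characteristic polynomial ([symmetric_deflation]). Splitting off [v1] once
    leaves a matrix with spectrum [lambda_2 <= ... <= lambda_n], and splitting
    off the remaining eigenvalues one at a time bounds its form below by
    [lambda_2]. Counting eigenvalues through the characteristic polynomial also
    covers the case where [lambda_1] is a multiple eigenvalue. *)

(** * The Euclidean inner product *)

Section LorentzQuadraticForms.
Context {R : realType}.

Lemma dotE n (x y : 'cV[R]_n) : dot x y = (x^T *m y) ord0 ord0.
Proof. by rewrite mxE; apply: eq_bigr => i _; rewrite mxE. Qed.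

Lemma dotC n (x y : 'cV[R]_n) : dot x y = dot y x.
Proof. by apply: eq_bigr => i _; rewrite mulrC. Qed.

Lemma dotDl n (x y z : 'cV[R]_n) : dot (x + y) z = dot x z + dot y z.
Proof. by rewrite !dotE linearD mulmxDl mxE. Qed.

Lemma dotZl n a (x y : 'cV[R]_n) : dot (a *: x) y = a * dot x y.
Proof. by rewrite !dotE linearZ -scalemxAl mxE. Qed.

Lemma dotDr n (x y z : 'cV[R]_n) : dot x (y + z) = dot x y + dot x z.
Proof. by rewrite !(dotC x) dotDl. Qed.

Lemma dotZr n a (x y : 'cV[R]_n) : dot x (a *: y) = a * dot x y.
Proof. by rewrite !(dotC x) dotZl. Qed.

Lemma dotBl n (x y z : 'cV[R]_n) : dot (x - y) z = dot x z - dot y z.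
Proof. by rewrite -[- y]scaleN1r dotDl dotZl mulN1r. Qed.

Lemma dotBr n (x y z : 'cV[R]_n) : dot x (y - z) = dot x y - dot x z.
Proof. by rewrite !(dotC x) dotBl. Qed.

Lemma dot_mulmxl {n} (A : 'M[R]_n) (x y : 'cV[R]_n) :
  dot (A *m x) y = dot x (A^T *m y).
Proof. by rewrite !dotE trmx_mul mulmxA. Qed.

Lemma dot_col_mx m n (a c : 'cV[R]_m) (b d : 'cV[R]_n) :
  dot (col_mx a b) (col_mx c d) = dot a c + dot b d.
Proof. by rewrite !dotE tr_col_mx mul_row_col mxE. Qed.

Lemma dot_ge0 n (x : 'cV[R]_n) : 0 <= dot x x.
Proof. by apply: sumr_ge0 => i _; rewrite -expr2 sqr_ge0. Qed.

Lemma dot_eq0 n (x : 'cV[R]_n) : (dot x x == 0) = (x == 0).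
Proof.
apply/eqP/eqP => [|->]; last by rewrite -(scale0r 0) dotZl mul0r.
move=> /(psumr_eq0P (fun i _ => sqr_ge0 (x i ord0))) x0.
by apply/matrixP=> i j; rewrite ord1 mxE; apply/eqP; rewrite -sqrf_eq0 x0.
Qed.

Lemma dot_gt0 {n} {x : 'cV[R]_n} : x != 0 -> 0 < dot x x.
Proof. by move=> x0; rewrite lt_neqAle eq_sym dot_eq0 x0 dot_ge0. Qed.

Lemma eucl_norm_sqr n (x : 'cV[R]_n) : eucl_norm x ^+ 2 = dot x x.
Proof. by rewrite sqr_sqrtr ?dot_ge0. Qed.

Lemma sphere_dot n (x : 'cV[R]_n) : sphere R n x -> dot x x = 1.
Proof. by rewrite /sphere /= -eucl_norm_sqr => ->; rewrite expr1n. Qed.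

Lemma dot_cauchy_schwarz n (x y : 'cV[R]_n) :
  dot x y ^+ 2 <= dot x x * dot y y.
Proof.
have [->|/dot_gt0 y_gt0] := eqVneq y 0.
  by rewrite -(scale0r 0) !dotZr !mul0r expr0n mulr0.
have := dot_ge0 (dot y y *: x - dot x y *: y).
rewrite dotBl !dotBr !dotZl !dotZr (dotC y x) => H.
rewrite -(ler_pM2l y_gt0); lra.
Qed.

(** * Spectral bounds for symmetric matrices *)

(** The reflection in the hyperplane orthogonal to [x - y] exchanges [x] and
    [y] when they have the same length. If [x = y], then [k = 2 / 0 = 0] and the
    same formula gives the identity matrix. *)
Lemma householder n (x y : 'cV[R]_n) : dot x x = dot y y ->
  exists H : 'M[R]_n, [/\ H^T = H, H *m H = 1%:M & H *m x = y].
Proof.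
move=> xy; pose w := x - y; pose k := 2 / dot w w.
have wwM (z : 'cV[R]_n) : w *m w^T *m z = dot w z *: w.
  by rewrite -mulmxA [w^T *m z]mx11_scalar -dotE mul_mx_scalar.
(* Multiplying by [w] keeps the identity true when [w = 0]. *)
have kww : k * dot w w *: w = 2 *: w.
  have [->|w0] := eqVneq w 0; first by rewrite !scaler0.
  by rewrite /k divfK // dot_eq0.
exists (1%:M - k *: (w *m w^T)); split.
- by rewrite linearB linearZ /= trmx1 trmx_mul trmxK.
- have kww2 : k *: (w *m w^T *m (w *m w^T)) = 2 *: (w *m w^T).
    by rewrite mulmxA wwM !scalemxAl scalerA kww.
  rewrite mulmxBr mulmx1 (mulmxBl 1%:M) mul1mx -scalemxAl -scalemxAr kww2.
  by rewrite scaler_nat mulr2n scalerDr opprB addrK subrK.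
- rewrite mulmxBl mul1mx -scalemxAl wwM scalerA.
  have -> : dot w x = dot w w / 2.
    by rewrite /w !dotBl !dotBr (dotC y x) -xy; lra.
  by rewrite mulrA mulrC -scalerA kww scalerA mulVf ?pnatr_eq0 // scale1r subKr.
Qed.

Lemma char_poly_conj n (H A : 'M[R]_n) : H *m H = 1%:M ->
  char_poly (H *m A *m H) = char_poly A.
Proof.
move=> HH; pose P := map_mx polyC H.
have PP : P *m P = 1%:M by rewrite -map_mxM HH map_mx1.
rewrite /char_poly; have -> : char_poly_mx (H *m A *m H) =
    P *m char_poly_mx A *m P.
  by rewrite /char_poly_mx mulmxBr mulmxBl !map_mxM scalar_mxC -(mulmxA _ P P) PP mulmx1.
by rewrite !det_mulmx mulrAC -det_mulmx PP det1 mul1r.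
Qed.

(** The reflection taking [v] to a multiple of the first basis vector turns [A]
    into [block_mx l 0 0 A'], the off-diagonal row vanishing by symmetry. Only
    the effect of this change of basis on the characteristic polynomial and on
    inner products is recorded: [t] and [y] are the coordinates of [z] along
    [v] and orthogonally to it. *)
Lemma symmetric_deflation n (A : 'M[R]_n.+1) l (v : 'cV[R]_n.+1) :
  A^T = A -> eigenvector A l v ->
  exists A' : 'M[R]_n, [/\ A'^T = A',
    char_poly A = ('X - l%:P) * char_poly A' &
    forall z, exists t (y : 'cV[R]_n),
      [/\ dot z z = t ^+ 2 + dot y y,
          dot (A *m z) z = l * t ^+ 2 + dot (A' *m y) y &
          dot v z = eucl_norm v * t]].
Proof.
rewrite -[n.+1]/(1 + n)%N in A v * => A_sym [v0 Av].
pose e : 'cV[R]_(1 + n) := col_mx 1%:M 0; pose N := eucl_norm v.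
have N_gt0 : 0 < N by rewrite sqrtr_gt0 dot_gt0.
have dot1 (a b : 'cV[R]_1) : dot a b = a ord0 ord0 * b ord0 ord0.
  by rewrite /dot big_ord1.
have ee : dot e e = 1.
  rewrite dot_col_mx dot1 mxE eqxx mulr1.
  by rewrite -[X in dot X _](scale0r 0) dotZl mul0r addr0.
have [|H [H_sym HH Hv]] := @householder _ v (N *: e).
  by rewrite dotZl dotZr ee mulr1 -expr2 eucl_norm_sqr.
pose B := H *m A *m H.
have B_sym : B^T = B by rewrite !trmx_mul A_sym H_sym mulmxA.
have Be : B *m e = l *: e.
  apply: (scalerI (lt0r_neq0 N_gt0)); rewrite scalemxAr -Hv.
  rewrite /B -!mulmxA (mulmxA H H) HH mul1mx Av -scalemxAr Hv.
  by rewrite !scalerA mulrC.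
have [A' [B_block A'_sym]] : exists A', B = block_mx (l%:M) 0 0 A' /\ A'^T = A'.
  exists (drsubmx B); split; last by rewrite trmx_drsub B_sym.
  rewrite -[LHS]submxK; move: Be.
  rewrite -{1}[B]submxK mul_block_col !mulmx1 !mulmx0 !addr0 scale_col_mx scaler0.
  move=> /eq_col_mx [-> dl0]; rewrite dl0 scalemx1.
  by rewrite -[ursubmx B]trmxK trmx_ursub B_sym dl0 trmx0.
exists A'; split=> //.
- rewrite -(char_poly_conj A HH) -/B B_block.
  rewrite /char_poly char_block_diag_mx det_ublock; congr (_ * _).
  by rewrite det_mx11 !mxE eqxx.
have Hdot x y : dot (H *m x) y = dot x (H *m y) by rewrite dot_mulmxl H_sym.
move=> z; have [u ->] : exists u, z = H *m u.
  by exists (H *m z); rewrite mulmxA HH mul1mx.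
have uE : u = col_mx (usubmx u) (dsubmx u) by rewrite vsubmxK.
move: (usubmx u) (dsubmx u) uE => t y ->.
exists (t ord0 ord0), y; split.
- by rewrite Hdot mulmxA HH mul1mx dot_col_mx dot1 expr2.
- rewrite -Hdot !mulmxA -/B B_block mul_block_col !mul0mx addr0 add0r.
  by rewrite dot_col_mx mul_scalar_mx dotZl dot1 expr2.
rewrite -Hdot Hv dotZl dot_col_mx dot1 mxE eqxx mul1r.
by rewrite -[X in dot X _](scale0r 0) dotZl mul0r addr0.
Qed.

(** Each root of the split characteristic polynomial provides an eigenvector,
    which is deflated; induction on the size bounds the remaining block. *)
Lemma quad_form_ge n (A : 'M[R]_n) (s : seq R) m : A^T = A ->
  char_poly A = \prod_(l <- s) ('X - l%:P) -> {in s, forall l, m <= l} ->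
  forall z, m * dot z z <= dot (A *m z) z.
Proof.
elim: n A s => [|n IH] A s A_sym Achar sm z.
  by rewrite /dot !big_ord0 mulr0.
case: s => [|l s] in Achar sm *.
  by have := size_char_poly A; rewrite Achar big_nil size_poly1.
(* [eigenvalue] speaks of row vectors, hence the transpositions. *)
have /eigenvalueP[x xA x0] : eigenvalue A l.
  by rewrite eigenvalue_root_char Achar big_cons rootM root_XsubC eqxx.
have [] := @symmetric_deflation _ A l x^T A_sym.
  by split; rewrite ?trmx_eq0 // -[in LHS]A_sym -trmx_mul xA linearZ.
move=> A' [A'_sym A'char A'form].
have {}A'char : char_poly A' = \prod_(l <- s) ('X - l%:P).
  by apply: (mulfI (negbT (polyXsubC_eq0 l))); rewrite -A'char Achar big_cons.
have [t [y [-> -> _]]] := A'form z.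
rewrite mulrDr lerD //; first by rewrite ler_wpM2r ?sqr_ge0 // sm ?mem_head.
by apply: IH A'_sym A'char _ y => i si; apply: sm; rewrite inE si orbT.
Qed.

(** Deflating [v] leaves a block whose spectrum is [lam] without its head, and
    a vector orthogonal to [v] lives in that block. *)
Lemma quad_form_ge_orthogonal n (A : 'M[R]_n.+2) (lam : n.+2.-tuple R) v z :
  A^T = A -> ordered_spectrum A lam -> eigenvector A lam`_0 v ->
  dot v z = 0 -> lam`_1 * dot z z <= dot (A *m z) z.
Proof.
case: lam => -[|l [|l1 s]] //= lam_size A_sym [ls Achar] v_eig vz.
have [A' [A'_sym A'char A'form]] := symmetric_deflation A_sym v_eig.
have {}A'char : char_poly A' = \prod_(l <- l1 :: s) ('X - l%:P).
  by apply: (mulfI (negbT (polyXsubC_eq0 l))); rewrite -A'char Achar [LHS]big_cons.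
have [t [y [-> -> vt]]] := A'form z.
have -> : t = 0.
  have : eucl_norm v * t == 0 by rewrite -vt vz.
  rewrite mulf_eq0 sqrtr_eq0 leNgt dot_gt0 /=; first by move/eqP.
  by case: v_eig.
rewrite expr0n mulr0 !add0r.
apply: (quad_form_ge A'_sym A'char) => i.
have /andP[_ +] : (l <= l1) && path <=%R l1 s by exact: ls.
rewrite (path_sortedE le_trans) => /andP[/allP l1_min _].
by rewrite inE => /orP[/eqP->//|/l1_min].
Qed.

(** A symmetric form that is nonnegative on a hyperplane obeys a reversed
    Cauchy-Schwarz inequality: two vectors of nonpositive square on the same
    side of the hyperplane have nonpositive product. The sign condition bears
    on [a * b] because a pair of nonpositive coefficients is as good. *)
Lemma quad_form_comb_le0 n (B : 'M[R]_n) v p q a b :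
  B^T = B -> (forall z, dot v z = 0 -> 0 <= dot (B *m z) z) ->
  0 < dot v p -> 0 < dot v q ->
  dot (B *m p) p <= 0 -> dot (B *m q) q <= 0 -> 0 <= a * b ->
  dot (B *m (a *: p + b *: q)) (a *: p + b *: q) <= 0.
Proof.
move=> B_sym B_ge0 p_gt0 q_gt0 Bp Bq ab.
have Bqp : dot (B *m q) p = dot (B *m p) q by rewrite dot_mulmxl B_sym dotC.
have Bpq : dot (B *m p) q <= 0.
  (* This combination is orthogonal to [v], and its cross term is the sought
     product with a negative factor. *)
  have := B_ge0 (dot v q *: p - dot v p *: q).
  rewrite dotBr !dotZr mulrC subrr => /(_ erefl).
  rewrite mulmxBr -!scalemxAr dotBl !dotBr !dotZl !dotZr Bqp => H.
  have := mulr_gt0 p_gt0 q_gt0; nra.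
rewrite mulmxDr -!scalemxAr dotDl !dotDr !dotZl !dotZr Bqp.
have := sqr_ge0 a; have := sqr_ge0 b; nra.
Qed.

(** * The Lorentz cone *)

Definition tail n (x : 'cV[R]_n.+1) : 'cV[R]_n :=
  \col_i x (lift ord0 i) ord0.

Lemma dot_head_tail n (x y : 'cV[R]_n.+1) :
  dot x y = x ord0 ord0 * y ord0 ord0 + dot (tail x) (tail y).
Proof.
by rewrite /dot big_ord_recl; congr (_ + _); apply: eq_bigr => i _; rewrite !mxE.
Qed.

Lemma lorentz_tail n (x : 'cV[R]_n.+1) : lorentz R n x ->
  0 <= x ord0 ord0 /\ dot (tail x) (tail x) <= x ord0 ord0 ^+ 2.
Proof.
rewrite /lorentz /= => Lx.
have x_ge0 := le_trans (sqrtr_ge0 _) Lx; split=> //.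
have -> : dot (tail x) (tail x) = \sum_(i < n.+1 | i != ord0) x i ord0 ^+ 2.
  rewrite [RHS]big_mkcond big_ord_recl /= add0r.
  by apply: eq_bigr => i _; rewrite !mxE expr2.
by rewrite -(ler_sqrt _ (sqr_ge0 _)) sqrtr_sqr ger0_norm.
Qed.

(** Half of the self-duality of the cone: by Cauchy-Schwarz the tails cannot
    outweigh the product of the first coordinates. *)
Lemma dot_lorentz_ge0 n (x y : 'cV[R]_n.+1) :
  lorentz R n x -> lorentz R n y -> 0 <= dot x y.
Proof.
move=> /lorentz_tail[x_ge0 Lx] /lorentz_tail[y_ge0 Ly].
rewrite dot_head_tail -lerBlDr sub0r.
apply: le_trans (ler_norm _) _; rewrite normrN.
rewrite -(ler_pXn2r (ltn0Sn 1)) ?nnegrE ?mulr_ge0 // real_normK ?num_real //.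
apply: le_trans (dot_cauchy_schwarz _ _) _.
by rewrite exprMn ler_pM // dot_ge0.
Qed.

(** An interior point stays in the cone after subtracting a small multiple
    [e *: x], so that [<x, y> >= e * <x, x> > 0]. *)
Lemma dot_interior_lorentz_gt0 n (x y : 'cV[R]_n.+1) :
  x != 0 -> lorentz R n x -> interior (lorentz R n) y -> 0 < dot x y.
Proof.
move=> x0 Lx y_int.
have shift_cvg : y - e *: x @[e --> (0 : R)^'+] --> y.
  rewrite -[X in _ --> X]subr0 -(scale0r x).
  apply: cvgB; first exact: cvg_cst.
  by apply: cvgZr_tmp; apply: cvg_at_right_filter; exact: cvg_id.
have /filter_ex[e [Le e_gt0]] :
    \forall e \near (0 : R)^'+, lorentz R n (y - e *: x) /\ 0 < e.
  near=> e; split; near: e; last exact: nbhs_right_gt.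
  exact: (shift_cvg _ y_int).
have := dot_lorentz_ge0 Lx Le; rewrite dotBr dotZr subr_ge0.
by apply: lt_le_trans; rewrite mulr_gt0 ?dot_gt0.
Unshelve. all: by end_near. Qed.

Lemma dot_lorentzJ_ge0 n (x : 'cV[R]_n.+1) : lorentz R n x ->
  0 <= dot (lorentzJ R n *m x) x.
Proof.
move=> /lorentz_tail[_ Lx]; rewrite dot_head_tail.
have -> : (lorentzJ R n *m x) ord0 ord0 = x ord0 ord0.
  by rewrite mul_diag_mx !mxE eqxx mul1r.
have -> : tail (lorentzJ R n *m x) = - tail x.
  by apply/matrixP => i j; rewrite mxE mul_diag_mx !mxE mulN1r.
by rewrite -scaleN1r dotZl mulN1r subr_ge0 -expr2.
Qed.

(** * Great circles *)

(** Both factors have the sign of [d]; stating the product keeps the two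
    directions of travel along an arc together. *)
Lemma sin_mul_sin_ge0 (d a : R) : - pi < d < pi -> 0 <= a <= 1 ->
  0 <= sin ((1 - a) * d) * sin (a * d).
Proof.
wlog d_ge0 : d / 0 <= d => [hwlog | /andP[_ d_lt] /andP[a_ge0 a_le1]].
  have [/hwlog//|d_lt0] := leP 0 d.
  move=> dpi a01; have := hwlog (- d); rewrite !mulrN !sinN mulrNN; apply=> //; lra.
by rewrite mulr_ge0 // sin_ge0_pi //; apply/andP; split; nra.
Qed.

(** The spherical interpolation formula, multiplied by [sin (t - s)] so as to
    remain valid when that sine vanishes. *)
Lemma great_circle_comb n (x u : 'cV[R]_n) (s t a : R) :
  let g r := cos r *: x + sin r *: u in
  sin (t - s) *: g ((1 - a) * s + a * t) =
  sin ((1 - a) * (t - s)) *: g s + sin (a * (t - s)) *: g t.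
Proof.
move=> g; rewrite /g.
have -> : (1 - a) * s + a * t = s + a * (t - s) by ring.
have -> : (1 - a) * (t - s) = (t - s) - a * (t - s) by ring.
have -> : cos t = cos (s + (t - s)) by congr cos; ring.
have -> : sin t = sin (s + (t - s)) by congr sin; ring.
move: (a * (t - s)) (t - s) => d e.
rewrite !scalerDr !scalerA addrACA -!scalerDl.
rewrite !cosD !sinD !cosN !sinN.
congr (_ *: x + _ *: u); ring.
Qed.

End LorentzQuadraticForms.

(** * Quasi-convexity *)

(* The dimension is n.+2, so that it is at least 2; the eigenvalues lambda_1
   and lambda_2 are lam`_0 and lam`_1. *)
Theorem theorem5p5p1 (R : realType) (n : nat) (A : 'M[R]_n.+2)
    (lam : (n.+2).-tuple R) (v1 : 'cV[R]_n.+2)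
    (A_sym : A^T = A)
    (A_two_eigenvalues : exists a b : R,
      [/\ a != b, eigenvalue A a & eigenvalue A b])
    (lam_spectrum : ordered_spectrum A lam)
    (v1_eigen : eigenvector A lam`_0 v1)
    (v1_lorentz : lorentz R n.+1 v1)
    (rho_psd : exists rho : R,
      0 <= rho /\ psdmx ((lam`_1)%:M - A - rho *: lorentzJ R n.+1)) :
  spherically_quasiconvex (sphere_lorentz R n.+1) (quad_form A).
Proof.
have [rho [rho_ge0 [_ M_psd]]] := rho_psd.
move=> x y g [_ _ _ _ [u [theta [_ _ /andP[th_gt0 th_lt] gE _]]]] gS s t a.
move=> s01 t01 a01 /=; set r := (1 - a) * s + a * t.
have r01 : 0 <= r <= 1 by rewrite /r; apply/andP; split; nra.
set c := Num.max _ _.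
have [fs ft] : quad_form A (g s) <= c /\ quad_form A (g t) <= c.
  by rewrite /c !le_max !lexx orbT.
have [/sphere_dot r1 /interior_subset Lr] := gS r r01.
have [/sphere_dot s1 Ls] := gS s s01; have [/sphere_dot t1 Lt] := gS t t01.
have [lam_c|c_lam] := leP lam`_1 c.
  apply: le_trans lam_c; have := M_psd (g r).
  rewrite !mulmxBl mul_scalar_mx -scalemxAl !dotBl !dotZl r1 mulr1.
  have := mulr_ge0 rho_ge0 (dot_lorentzJ_ge0 Lr).
  rewrite /quad_form; lra.
pose B := A - c%:M.
have BE z : dot (B *m z) z = dot (A *m z) z - c * dot z z.
  by rewrite mulmxBl mul_scalar_mx dotBl dotZl.
have B_sym : B^T = B by rewrite linearB /= A_sym tr_scalar_mx.
have B_ge0 z : dot v1 z = 0 -> 0 <= dot (B *m z) z.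
  move=> /(quad_form_ge_orthogonal A_sym lam_spectrum v1_eigen) Az.
  by rewrite BE subr_ge0 (le_trans _ Az) // ler_wpM2r ?dot_ge0 // ltW.
have v1_neq0 : v1 != 0 by case: v1_eigen.
have v1s := dot_interior_lorentz_gt0 v1_neq0 v1_lorentz Ls.
have v1t := dot_interior_lorentz_gt0 v1_neq0 v1_lorentz Lt.
have Bs : dot (B *m g s) (g s) <= 0 by rewrite BE s1 mulr1 subr_le0.
have Bt : dot (B *m g t) (g t) <= 0 by rewrite BE t1 mulr1 subr_le0.
(* Since [g r] is a unit vector, the claim is that its [B]-square is
   nonpositive. *)
rewrite -subr_le0 /quad_form -[c]mulr1 -r1 -BE.
pose d := t * theta - s * theta.
have [st|s_neq_t] := eqVneq s t.
  by have -> : r = s by rewrite /r -st; ring.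
have d_pi : - pi < d < pi by rewrite /d; apply/andP; split; nra.
have sin_d : 0 < sin d ^+ 2.
  rewrite exprn_even_gt0 //=.
  have [d_gt0|d_lt0|d0] := ltgtP 0 d.
  - by rewrite gt_eqF // sin_gt0_pi //; lra.
  - by rewrite -oppr_eq0 -sinN gt_eqF // sin_gt0_pi //; lra.
  - move/eqP: d0; rewrite eq_sym /d -mulrBl mulf_eq0 (gt_eqF th_gt0) orbF.
    by rewrite subr_eq0 eq_sym (negPf s_neq_t).
have /= := great_circle_comb x u (s * theta) (t * theta) a.
have -> : (1 - a) * (s * theta) + a * (t * theta) = r * theta by rewrite /r; ring.
rewrite -!gE // -/d => grE.
have := quad_form_comb_le0 B_sym B_ge0 v1s v1t Bs Bt (sin_mul_sin_ge0 d_pi a01).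
by rewrite -grE -scalemxAr dotZl dotZr mulrA -expr2 pmulr_rle0.
Qed.
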